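(* For all integers $S\geq 2$ and $T\geq 3$, the semigroup $\mathbb{N}A_{S,T}$ generated by the columns of the design matrix $A_{S,T}$ of the toric homogeneous Markov chain model without initial parameters (self-loops allowed) is not normal.
   Context: Let $[S]=\{1,\dots,S\}$ and let $[S]^T$ be the set of all words $w=(s_1,\dots,s_T)$ of length $T$ on $[S]$. The design matrix $A_{S,T}$ is the $S^2\times S^T$ matrix with rows indexed by $[S]^2$ and columns indexed by $[S]^T$, whose entry in row $(i,j)$ and column $w=(s_1,\dots,s_T)$ is the number of $t\in\{1,\dots,T-1\}$ with $(s_t,s_{t+1})=(i,j)$. For an integer matrix $A\in\mathbb{Z}^{d\times m}$ with columns $A_1,\dots,A_m$, let $\mathbb{N}A=\{n_1A_1+\cdots+n_mA_m\mid n_i\in\mathbb{N}\}$ with $\mathbb{N}=\{0,1,2,\dots\}$. The semigroup $\mathbb{N}A$ is called normal if: $x\in\mathbb{N}A$ if and only if there exist $y\in\mathbb{Z}^m$ and $\alpha\in\mathbb{R}^m_{\geq 0}$ with $x=Ay$ and $x=A\alpha$. *)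

(* Defs.v *)
From HB Require Import structures.
From mathcomp Require Import all_boot all_order all_algebra.
From mathcomp Require Import reals.

Set Implicit Arguments.
Unset Strict Implicit.
Unset Printing Implicit Defensive.

Import Order.TTheory GRing.Theory Num.Theory.

Local Open Scope ring_scope.

(* [zip w (behead w)] lists the T - 1 pairs (s_t, s_(t+1)) of w in order. *)
Definition transitions (S T : nat) (w : T.-tuple 'I_S) : seq ('I_S * 'I_S) :=
  zip w (behead w).

(* MathComp matrices are indexed by ordinals: rows and columns are numbered by
   the canonical enumerations of the pairs of states and of the words. *)
Definition design_matrix (S T : nat) :
    'M[int]_(#|{: 'I_S * 'I_S}|, #|{: T.-tuple 'I_S}|) :=
  \matrix_(r, c) (count_mem (enum_val r) (transitions (enum_val c)))%:Z.

Definition in_semigroup (d m : nat) (A : 'M[int]_(d, m)) (x : 'cV[int]_d) :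
    Prop :=
  exists n : 'cV[nat]_m, x = A *m map_mx Posz n.

(* In the last equation x and A are viewed over the reals. *)
Definition normal_semigroup (R : realType) (d m : nat) (A : 'M[int]_(d, m)) :
    Prop :=
  forall x : 'cV[int]_d,
    in_semigroup A x <->
    exists (y : 'cV[int]_m) (alpha : 'cV[R]_m),
      [/\ forall j, 0 <= alpha j 0,
          x = A *m y
        & map_mx intr x = map_mx intr A *m alpha].

(* Main.v *)
Require Import Defs.
From HB Require Import structures.
From mathcomp Require Import all_boot all_order all_algebra.
From mathcomp Require Import reals.
From mathcomp Require Import ring.

Set Implicit Arguments.
Unset Strict Implicit.
Unset Printing Implicit Defensive.

Import Order.TTheory GRing.Theory Num.Theory.

(** Let [n = T - 1 >= 2] be the number of transitions of a word and pick two
distinct states [a] and [b].  The vector [x] with entry [n - 1] at the loop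
[(a, a)], entry [1] at the loop [(b, b)] and [0] elsewhere is a hole of the
semigroup:
- it lies in the cone, as [(n - 1) / n] times the column of the word [a ... a]
  (which is [n] at [(a, a)]) plus [1 / n] times the column of [b ... b];
- it lies in the lattice, because the columns of [a ... a b b] and [a ... a b]
  differ exactly by exchanging one loop [(a, a)] for one loop [(b, b)], and that
  exchange can be added to the column of [a ... a];
- it is not in the semigroup.  Some word used in a decomposition of [x] would
  contain the transition [(b, b)]; since [x] vanishes outside loops, this word
  would only contain loops, so it would be the constant word [b ... b].  Its
  column has entry [n >= 2] at [(b, b)], which exceeds the entry [1] of [x]
  (lemma [loops_not_in_semigroup]). *)

Local Open Scope ring_scope.

Section Pairs.
Variable U : eqType.
Implicit Types (a b : U) (w : seq U).

Lemma zip_behead_nseq a k :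
  zip (nseq k.+1 a) (behead (nseq k.+1 a)) = nseq k (a, a).
Proof. by elim: k => //= k ->. Qed.

Lemma zip_behead_nseq_cat a b p q :
  zip (nseq p.+1 a ++ nseq q.+1 b) (behead (nseq p.+1 a ++ nseq q.+1 b)) =
  nseq p (a, a) ++ (a, b) :: nseq q (b, b).
Proof.
elim: p => [|p IHp]; last by rewrite /= -IHp.
by rewrite -(zip_behead_nseq b q).
Qed.

Lemma constant_of_loops a w :
  {in zip (a :: w) w, forall p, p.1 = p.2} -> w = nseq (size w) a.
Proof.
elim: w a => [//|c w IHw] a loops /=.
have eq_ac : a = c by apply: (loops (a, c)); rewrite /= mem_head.
rewrite -eq_ac in loops *; congr (_ :: _); apply: IHw => p pw.
by apply: loops; rewrite /= in_cons pw orbT.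
Qed.

(** Multiplicity [size w - 1] of the loop at [b] is forced as soon as the loop
occurs, because without transitions between distinct states a word never leaves
its first letter. *)
Lemma count_loop_of_loops b w :
    {in zip w (behead w), forall p, p.1 = p.2} ->
    (b, b) \in zip w (behead w) ->
  count_mem (b, b) (zip w (behead w)) = (size w).-1.
Proof.
case: w => [//|a w] /= /constant_of_loops ->; rewrite size_nseq.
rewrite (zip_behead_nseq a).
by rewrite mem_nseq count_nseq /= eq_sym => /andP[_ ->]; rewrite mul1n.
Qed.

End Pairs.

(** Nothing cancels in a sum of nonnegative columns: a nonzero entry of [x] comes
from one of the summed columns, and no summed column exceeds [x] anywhere. *)
Lemma in_semigroup_col_le (d m : nat) (A : 'M[int]_(d, m)) (x : 'cV[int]_d)
    (i : 'I_d) :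
    (forall r c, 0 <= A r c) -> in_semigroup A x -> x i 0 != 0 ->
  exists c, A i c != 0 /\ forall r, A r c <= x r 0.
Proof.
move=> A_ge0 [n ->]; rewrite mxE => sum_neq0.
have [c Ac] : exists c, A i c * (n c 0%R)%:Z != 0.
  apply/existsP; apply: contraNT sum_neq0 => /existsPn zero.
  by rewrite big1 // => c _; rewrite mxE; apply/eqP; rewrite -[_ == _]negbK.
move: Ac; rewrite mulf_eq0 negb_or => /andP[Ac nc].
exists c; split=> // r; rewrite mxE (bigD1 c) //= mxE.
rewrite -[leLHS]addr0 lerD //.
  by rewrite ler_peMr //; case: (n c 0) nc.
by apply: sumr_ge0 => j _; rewrite mxE mulr_ge0.
Qed.

Section DesignMatrix.
Variables S T : nat.

Definition word_index (w : T.-tuple 'I_S) : 'I_#|{: T.-tuple 'I_S}| :=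
  enum_rank w.

Lemma design_matrix_word r (w : T.-tuple 'I_S) :
  design_matrix S T r (word_index w) =
  (count_mem (enum_val r) (transitions w))%:Z.
Proof. by rewrite mxE enum_rankK. Qed.

Definition loops_vector (a b : 'I_S) (p q : nat) :
    'cV[int]_#|{: 'I_S * 'I_S}| :=
  \col_r ((p * ((a, a) == enum_val r) + q * ((b, b) == enum_val r))%N)%:Z.

(** A word contributing to the entry [1] at [(b, b)] may not leave [b], as the vector has
no transition between distinct states; but then it has [T - 1 > 1] loops at
[b]. *)
Lemma loops_not_in_semigroup (a b : 'I_S) (p : nat) :
    (3 <= T)%N -> a != b ->
  ~ in_semigroup (design_matrix S T) (loops_vector a b p 1).
Proof.
move=> hT neq_ab; pose rb := enum_rank (b, b).
have xb : loops_vector a b p 1 rb 0 = 1.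
  by rewrite mxE enum_rankK eqxx xpair_eqE (negPf neq_ab) muln0.
move=> /(@in_semigroup_col_le _ _ _ _ rb)[].
- by move=> r c; rewrite mxE.
- by rewrite xb.
move=> c; rewrite -[c](enum_valK) -/(word_index _); set w := enum_val c.
move=> [wb w_le].
have loops : {in zip w (behead w), forall p, p.1 = p.2}.
  (* A non-loop transition of [w] would exceed a zero entry of the vector. *)
  move=> [i j] w_ij; apply/eqP; apply: contraLR (w_le (enum_rank (i, j))) => /=.
  move=> neq_ij; rewrite design_matrix_word mxE enum_rankK.
  have no_loop s : ((s, s) == (i, j)) = false.
    by apply: contraNF neq_ij; rewrite xpair_eqE => /andP[/eqP<- /eqP<-].
  by rewrite !no_loop !muln0 -ltNge ltz_nat -has_count has_pred1.
have := w_le rb; move: wb; rewrite design_matrix_word xb enum_rankK.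
rewrite eqz_nat -lt0n -has_count has_pred1 => w_bb.
rewrite /transitions count_loop_of_loops // size_tuple lez_nat leqNgt.
by case: T hT => [|[|[|]]].
Qed.

End DesignMatrix.

Lemma design_matrix_nseq (S k : nat) (a : 'I_S) r :
  design_matrix S k.+1 r (word_index (nseq_tuple k.+1 a)) =
  (k * ((a, a) == enum_val r))%N%:Z.
Proof.
rewrite design_matrix_word /transitions [tval _]/=.
by rewrite -/(nseq k.+1 a) zip_behead_nseq count_nseq mulnC.
Qed.

Lemma design_matrix_nseq_cat (S T p q : nat) (a b : 'I_S) (w : T.-tuple 'I_S) r :
    w = nseq p.+1 a ++ nseq q.+1 b :> seq 'I_S ->
  design_matrix S T r (word_index w) =
  (p * ((a, a) == enum_val r) +
   (((a, b) == enum_val r) + q * ((b, b) == enum_val r)))%N%:Z.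
Proof.
move=> def_w; rewrite design_matrix_word /transitions def_w.
rewrite zip_behead_nseq_cat count_cat /= !count_nseq /=.
by rewrite (mulnC p) (mulnC q).
Qed.

(** The difference of the columns of [a ... a b b] and [a ... a b] trades one loop
at [a] for one loop at [b], since both words cross from [a] to [b] once; adding
it to the column of [a ... a] gives the vector. *)
Lemma loops_vector_in_lattice (S k : nat) (a b : 'I_S) :
  exists y, loops_vector a b k.+1 1 = design_matrix S k.+3 *m y.
Proof.
have sz_abb : size (nseq k.+1 a ++ nseq 2 b) == k.+3.
  by rewrite size_cat !size_nseq addn2.
have sz_ab : size (nseq k.+2 a ++ nseq 1 b) == k.+3.
  by rewrite size_cat !size_nseq addn1.
pose w_abb := word_index (Tuple sz_abb).
pose w_ab := word_index (Tuple sz_ab).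
pose w_a := word_index (nseq_tuple k.+3 a).
exists (delta_mx w_abb 0 - delta_mx w_ab 0 + delta_mx w_a 0).
apply/colP => r.
have col_abb : design_matrix S k.+3 r w_abb = _ :=
  @design_matrix_nseq_cat _ _ k 1 a b (Tuple sz_abb) r erefl.
have col_ab : design_matrix S k.+3 r w_ab = _ :=
  @design_matrix_nseq_cat _ _ k.+1 0 a b (Tuple sz_ab) r erefl.
have col_a : design_matrix S k.+3 r w_a = _ := @design_matrix_nseq _ _ a r.
rewrite mulmxDr mulmxBr -!colE.
move: (design_matrix S k.+3) col_abb col_ab col_a => A col_abb col_ab col_a.
rewrite !mxE col_abb col_ab col_a !PoszD !PoszM.
by ring.
Qed.

(** The columns of the constant words are positive multiples of the unit vectors
at [(a, a)] and [(b, b)], so dividing by the number [k + 1] of transitions gives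
any combination of the two loops. *)
Lemma loops_vector_in_cone (R : realType) (S k : nat) (a b : 'I_S) p q :
  exists alpha : 'cV[R]_#|{: k.+2.-tuple 'I_S}|,
    (forall j, 0 <= alpha j 0) /\
    map_mx intr (loops_vector a b p q) =
    map_mx intr (design_matrix S k.+2) *m alpha.
Proof.
pose w_a := word_index (nseq_tuple k.+2 a).
pose w_b := word_index (nseq_tuple k.+2 b).
exists ((p%:R / k.+1%:R) *: delta_mx w_a 0 + (q%:R / k.+1%:R) *: delta_mx w_b 0).
split=> [j|].
  by rewrite !mxE addr_ge0 // mulr_ge0 // ?divr_ge0 ?ler0n.
have k_neq0 : k.+1%:R != 0 :> R by rewrite pnatr_eq0.
apply/colP => r.
have col_a : design_matrix S k.+2 r w_a = _ := @design_matrix_nseq _ _ a r.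
have col_b : design_matrix S k.+2 r w_b = _ := @design_matrix_nseq _ _ b r.
rewrite mulmxDr -!scalemxAr -!colE.
move: (design_matrix S k.+2) col_a col_b => A col_a col_b.
rewrite !mxE col_a col_b -!pmulrn natrD !natrM.
by rewrite !mulrA !divfK.
Qed.

Theorem lemma4p3 (R : realType) (S T : nat) (hS : (2 <= S)%N) (hT : (3 <= T)%N) :
  ~ normal_semigroup R (design_matrix S T).
Proof.
pose a : 'I_S := Ordinal (ltnW hS); pose b : 'I_S := Ordinal hS.
case: T hT => [|[|[|k]]] // hT normal.
apply: (@loops_not_in_semigroup S k.+3 a b k.+1) => //.
have [y xAy] := loops_vector_in_lattice k a b.
have [alpha [alpha_ge0 xAalpha]] := loops_vector_in_cone R k.+1 a b k.+1 1.
by apply/normal; exists y, alpha.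
Qed.
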